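(* Let $S(t)$, $t\in\mathbb R$, be the solution group on $H^1(\mathbb T)$ of the linear equation $$(1-\partial_x^2)u_t+u_x=0,$$ i.e. $S(t)f$ is the solution with initial value $f$. Let $T>0$ and $f\in H^1(\mathbb T)$. (i) If $S(t)f$ vanishes on $\omega\times(0,T)$ for some nonempty open $\omega\subset\mathbb T$, then $f=0$. (ii) If, for a single fixed point $x_0\in\mathbb T$, $S(t)f(x_0)=0$ for all $0<t<T$, then $f=0$.
   Context: $\mathbb T=\mathbb R/(2\pi\mathbb Z)$ (period exactly $2\pi$). Functions may be complex valued. Explicitly, $S(t)f(x)=\sum_{k\in\mathbb Z}\widehat f(k)e^{\lambda_kt}e^{ikx}$ with $\lambda_k=-\frac{ik}{1+k^2}$. Point values refer to continuous representatives. *)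

(* Defs.v *)
From HB Require Import structures.
From mathcomp Require Import all_boot all_order all_algebra.
From mathcomp Require Import all_classical all_reals all_analysis.
From mathcomp Require Import complex.

Set Implicit Arguments.
Unset Strict Implicit.
Unset Printing Implicit Defensive.

Import Order.TTheory GRing.Theory Num.Theory.
Import numFieldNormedType.Exports.

Local Open Scope classical_set_scope.
Local Open Scope ring_scope.
Local Open Scope complex_scope.

(* Functions on the circle T = R / (2 pi Z) are 2 pi-periodic functions on R,
   and subsets of T are 2 pi-invariant subsets of R. *)

Definition periodic_2pi (R : realType) (f : R -> R[i]) : Prop :=
  forall x : R, f (x + 2 * pi) = f x.

Definition invariant_2pi (R : realType) (omega : set R) : Prop :=
  forall x : R, omega (x + 2 * pi) <-> omega x.

Definition cexp (R : realType) (z : R[i]) : R[i] :=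
  (expR (complex.Re z))%:C * (cos (complex.Im z) +i* sin (complex.Im z)).

Definition circle_integral (R : realType) (g : R -> R[i]) : R[i] :=
  (\int[lebesgue_measure]_(x in `[0, 2 * pi]) complex.Re (g x))
  +i* (\int[lebesgue_measure]_(x in `[0, 2 * pi]) complex.Im (g x)).

Definition fourier (R : realType) (f : R -> R[i]) (k : int) : R[i] :=
  (2 * pi)^-1%:C * circle_integral (fun x => f x * cexp (- ('i * k%:~R * x%:C))).

(* Elements of L^2(T) and H^1(T) are represented by functions, with equality
   of elements being equality almost everywhere. *)

Definition in_L2 (R : realType) (f : R -> R[i]) : Prop :=
  [/\ periodic_2pi f,
      measurable_fun [set: R] (fun x => complex.Re (f x)),
      measurable_fun [set: R] (fun x => complex.Im (f x)) &
      (\int[lebesgue_measure]_(x in `[0%R, (2 * pi)%R])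
         ((Normc.normc (f x)) ^+ 2)%:E < +oo)%E].

Definition in_H1 (R : realType) (f : R -> R[i]) : Prop :=
  in_L2 f /\
  (\esum_(k in [set: int])
     ((1 + k%:~R ^+ 2) * (Normc.normc (fourier f k)) ^+ 2)%:E < +oo)%E.

Definition climn (R : realType) (u : nat -> R[i]) : R[i] :=
  limn (fun n => complex.Re (u n)) +i* limn (fun n => complex.Im (u n)).

Definition zseries (R : realType) (a : int -> R[i]) : R[i] :=
  climn (fun N => \sum_(j < (2 * N).+1) a (j%:Z - N%:Z)).

Definition lambda (R : realType) (k : int) : R[i] :=
  - ('i * k%:~R / (1 + k%:~R ^+ 2)).

(* The exponential e^(lambda_k t) e^(i k x) solves (1 - d_x^2) u_t + u_x = 0. *)
Lemma lambda_dispersion (R : realType) (k : int) :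
  (1 - ('i * k%:~R) ^+ 2) * lambda R k + 'i * k%:~R = 0 :> R[i].
Proof.
have k0 : 1 + k%:~R ^+ 2 != 0 :> R[i].
  by rewrite -rmorphXn -(intrD _ 1) intr_eq0 gt_eqF// ltr_pwDl// sqr_ge0.
by rewrite exprMn sqr_i mulN1r opprK mulrN mulrCA divff// mulr1 addNr.
Qed.

(* For f in H^1(T) the coefficients are absolutely summable, so the series
   converges uniformly in x and its pointwise sum is the continuous
   representative of the solution at time t with initial value f. *)
Definition solution_group (R : realType) (t : R) (f : R -> R[i]) (x : R) : R[i] :=
  zseries (fun k : int =>
    fourier f k * cexp (lambda R k * t%:C) * cexp ('i * k%:~R * x%:C)).

(* Main.v *)
Require Import Defs.
From HB Require Import structures.
From mathcomp Require Import all_boot all_order all_algebra.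
From mathcomp Require Import all_classical all_reals all_analysis.
From mathcomp Require Import complex measurable_realfun.
From mathcomp Require Import zify ring lra.

Set Implicit Arguments.
Unset Strict Implicit.
Unset Printing Implicit Defensive.

Import Order.TTheory GRing.Theory Num.Theory.
Import numFieldNormedType.Exports.

Local Open Scope classical_set_scope.
Local Open Scope ring_scope.
Local Open Scope complex_scope.

(* At a fixed x0 the solution is an absolutely convergent series
   sum_k c_k e^(-i mu_k t) with mu_k = k / (1 + k^2) and
   c_k = fourier f k * e^(i k x0).  The frequencies are pairwise distinct and
   lie in [-1/2, 1/2].  Multiply by e^(i mu_j t), so that the frequencies become
   nu_k = mu_j - mu_k, with nu_k = 0 only for k = j.  If the sum vanishes for t
   in an interval, so do its derivatives, hence so does the series whose terms
   are multiplied by (1 - nu_k^2)^n; as n grows this multiplier tends to 1 at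
   k = j and to 0 elsewhere, so c_j = 0 by dominated convergence.  No gap
   condition is used, which is why the accumulation of the mu_k at 0 is harmless.

   A function of L^2(T) with no nonzero Fourier coefficient vanishes almost
   everywhere: with s an affine function of cos(x - b/2) that is < 1/2 on (0, b)
   and > 1/2 on (b, 2 pi), the trigonometric polynomials (1 - s^n)^(2^n) are
   bounded by 1 and converge to the indicator of (0, b); so the integral over
   [0, b] is 0 for all b, and one differentiates in b. *)

(** * Uniqueness of Fourier coefficients *)

Lemma bernoulli_ge (R : realFieldType) (y : R) (m : nat) :
  0 <= y <= 1 -> 1 - m%:R * y <= (1 - y) ^+ m.
Proof.
move=> /andP[y0 y1]; elim: m => [|m IH]; first by rewrite mul0r subr0 expr0.
rewrite exprS; apply: le_trans (ler_wpM2l _ IH); last by rewrite subr_ge0.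
rewrite -natr1; have : 0 <= m%:R * y * y by rewrite !mulr_ge0.
by nra.
Qed.

(** The left-hand side decreases in [m], because [(1 - y) * (1 + (m + 1) * y) <= 1 + m * y]. *)
Lemma bernoulli_le (R : realFieldType) (y : R) (m : nat) :
  0 <= y <= 1 -> (1 - y) ^+ m * (1 + m%:R * y) <= 1.
Proof.
move=> /andP[y0 y1]; elim: m => [|m IH].
  by rewrite expr0 mul0r addr0 mul1r.
apply: le_trans IH; rewrite exprSr -mulrA ler_wpM2l//.
  by rewrite exprn_ge0// subr_ge0.
rewrite -natr1; have : 0 <= m%:R * y * y by rewrite !mulr_ge0.
by nra.
Qed.

(** The polynomial of the Brosowski-Deutsch proof of Stone-Weierstrass. Since [2 ^ n * s ^ n] tends
    to 0 or to infinity according to the side of 1/2 on which [s] lies, the threshold is at 1/2. *)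
Definition switch (R : pzRingType) (n : nat) (s : R) : R :=
  (1 - s ^+ n) ^+ (2 ^ n).

Lemma switch_itv (R : realFieldType) (n : nat) (s : R) :
  0 <= s <= 1 -> 0 <= switch n s <= 1.
Proof.
move=> /andP[s0 s1]; have sn0 := exprn_ge0 n s0; have sn1 := exprn_ile1 n s0 s1.
have h : 0 <= 1 - s ^+ n by rewrite subr_ge0.
by rewrite exprn_ge0//= exprn_ile1// gerBl.
Qed.

Lemma cvg_switch1 (R : realType) (s : R) :
  0 <= s < 2^-1 -> switch n s @[n --> \oo] --> (1 : R).
Proof.
move=> /andP[s0 s1].
have s01 : 0 <= s <= 1 by rewrite s0/=; lra.
apply: (@squeeze_cvgr _ _ _ _ (fun n => 1 - (2 * s) ^+ n) (cst 1)).
- apply: nearW => n; have /andP[_ ->] := switch_itv n s01; rewrite andbT.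
  rewrite exprMn -natrX bernoulli_ge//.
  by case/andP: s01 => ? ?; rewrite exprn_ge0//= exprn_ile1.
- rewrite -[X in _ --> X]subr0; apply: cvgB; first exact: cvg_cst.
  by apply: cvg_expr; rewrite ger0_norm ?mulr_ge0//; lra.
- exact: cvg_cst.
Qed.

Lemma cvg_switch0 (R : realType) (s : R) :
  2^-1 < s <= 1 -> switch n s @[n --> \oo] --> (0 : R).
Proof.
move=> /andP[s0 s1].
have s01 : 0 <= s <= 1 by rewrite s1 andbT; lra.
apply: (@squeeze_cvgr _ _ _ _ (cst 0) (fun n => (2 * s)^-1 ^+ n)).
- apply: nearW => n; have /andP[b0 _] := switch_itv n s01; rewrite b0/=.
  have sn : 0 < (2 * s) ^+ n by rewrite exprn_gt0//; lra.
  rewrite exprVn -div1r ler_pdivlMr//.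
  have sn01 : 0 <= s ^+ n <= 1.
    by case/andP: s01 => ? ?; rewrite exprn_ge0//= exprn_ile1.
  apply: le_trans (bernoulli_le (2 ^ n) sn01); rewrite ler_wpM2l//.
  by rewrite exprMn natrX lerDr.
- exact: cvg_cst.
- apply: cvg_expr; rewrite ger0_norm ?invr_ge0; last by lra.
  by rewrite invf_lt1; lra.
Qed.

Lemma measurable_cos_affine (R : realType) (a b : R) :
  measurable_fun setT (fun x : R => cos (a * x + b)).
Proof.
apply: continuous_measurable_fun => x.
apply: (@continuous_comp _ _ _ (fun y => a * y + b)); last exact: continuous_cos.
by apply: cvgD; [apply: cvgM; [exact: cvg_cst|exact: cvg_id]|exact: cvg_cst].
Qed.

(** * Real functions orthogonal to all cosines with phase *)

Section fourier_uniqueness.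
Context {R : realType}.
Notation mu := (@lebesgue_measure R).
Local Notation D := (`[0, 2 * pi]%classic : set R).

Lemma integrable_mul_bounded (E : set R) (g p : R -> R) (M : R) :
  measurable E -> mu.-integrable E (EFin \o g) -> measurable_fun setT p ->
  (forall x, `|p x| <= M) -> mu.-integrable E (EFin \o (fun x => g x * p x)).
Proof.
move=> mE ig mp pM.
have -> : EFin \o (fun x => g x * p x) = ((EFin \o g) \* (EFin \o p))%E.
  by apply/funext => x /=; rewrite EFinM.
apply: integrableMl => //; first exact: measurable_funTS.
exists M; split; first exact: num_real.
by move=> N MN x _ /=; exact: le_trans (pM x) (ltW MN).
Qed.

(* Vanishing is asked for every phase [phi], so that multiplying [p] by
   [cos (x - h)] only shifts [k] and [phi]. *)
Definition null_multiplier (g p : R -> R) : Prop :=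
  [/\ measurable_fun setT p, exists M, forall x, `|p x| <= M &
    forall (k : int) (phi : R),
      \int[mu]_(x in D) (g x * p x * cos (k%:~R * x + phi)) = 0].

Variable g : R -> R.
Hypothesis ig : mu.-integrable D (EFin \o g).

Let imul (p : R -> R) (M a b : R) : measurable_fun setT p ->
  (forall x, `|p x| <= M) ->
  mu.-integrable D (EFin \o (fun x => g x * p x * cos (a * x + b))).
Proof.
move=> mp pM; apply: (@integrable_mul_bounded _ _ _ 1) => //.
- exact: integrable_mul_bounded ig mp pM.
- exact: measurable_cos_affine.
- by move=> x; exact: cos_max.
Qed.

Lemma null_multiplierM (p : R -> R) (c d h : R) :
  null_multiplier g p ->
  null_multiplier g (fun x => (c + d * cos (x - h)) * p x).
Proof.
move=> [mp [M pM] p0]; split.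
- apply: measurable_funM => //; apply: measurable_funD => //.
  apply: measurable_funM => //.
  by have := measurable_cos_affine 1 (- h); under eq_fun do rewrite mul1r.
- exists ((`|c| + `|d|) * M) => x; rewrite normrM ler_pM//.
  apply: le_trans (ler_normD _ _) _; rewrite lerD2l normrM.
  by rewrite ler_piMr// cos_max.
- move=> k phi.
  under eq_Rintegral => x _.
    have -> : g x * ((c + d * cos (x - h)) * p x) * cos (k%:~R * x + phi) =
      c * (g x * p x * cos (k%:~R * x + phi)) +
      (d / 2 * (g x * p x * cos ((k + 1)%:~R * x + (phi - h))) +
       d / 2 * (g x * p x * cos ((k - 1)%:~R * x + (phi + h)))).
      have -> : (k + 1)%:~R * x + (phi - h) = (k%:~R * x + phi) + (x - h).
        by rewrite intrD; ring.
      have -> : (k - 1)%:~R * x + (phi + h) = (k%:~R * x + phi) - (x - h).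
        by rewrite intrB; ring.
      by rewrite (cosD (_ + phi)) (cosB (_ + phi)); field.
    over.
  have i1 (e : R) (l : int) (psi : R) : mu.-integrable D
      (EFin \o (fun x => e * (g x * p x * cos (l%:~R * x + psi)))).
    by apply: (integrableZl _ e (imul l%:~R psi mp pM)).
  have i2 : mu.-integrable D (EFin \o (fun x : R =>
      d / 2 * (g x * p x * cos ((k + 1)%:~R * x + (phi - h))) +
      d / 2 * (g x * p x * cos ((k - 1)%:~R * x + (phi + h))))).
    by apply: (integrableD _ (i1 _ _ _) (i1 _ _ _)).
  rewrite RintegralD//.
  rewrite RintegralD// !RintegralZl//; try exact: imul pM.
  by rewrite !p0 !mulr0 !addr0.
Qed.

Lemma null_multiplierB (p q : R -> R) :
  null_multiplier g p -> null_multiplier g q ->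
  null_multiplier g (fun x => p x - q x).
Proof.
move=> [mp [M pM] p0] [mq [N qN] q0]; split.
- exact: measurable_funB.
- exists (M + N) => x; apply: le_trans (ler_normB _ _) _.
  exact: lerD.
- move=> k phi.
  under eq_Rintegral => x _ do rewrite mulrBr mulrBl.
  by rewrite RintegralB ?p0 ?q0 ?subr0//; [exact: imul pM|exact: imul qN].
Qed.

(** The function s of the overview, with [h = b / 2]. It takes the value 1/2 at 0 and at [2 * h],
    and the factor 1/4 keeps it in [0, 1]. Its form is the one [null_multiplierM] accepts. *)
Let step (h x : R) : R := 2^-1 + 4^-1 * cos h + (- 4^-1) * cos (x - h).

Lemma null_multiplier_switch (h : R) (n : nat) :
  null_multiplier g (cst 1) -> null_multiplier g (fun x => switch n (step h x)).
Proof.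
move=> n1.
(* Inner induction over the powers of [step]; the outer one runs over the [2 ^ n] factors of
   [switch]. *)
have nX p m : null_multiplier g p ->
    null_multiplier g (fun x => step h x ^+ m * p x).
  move=> np; elim: m => [|m IH].
    by under eq_fun do rewrite expr0 mul1r.
  under eq_fun do rewrite exprS -mulrA.
  exact: null_multiplierM.
rewrite /switch; elim: (2 ^ n)%N => [|m IH].
  by under eq_fun do rewrite expr0.
under eq_fun do rewrite exprS mulrBl mul1r.
by apply: null_multiplierB => //; exact: nX.
Qed.

Let sin_half_gt0 (x : R) : 0 < x < 2 * pi -> 0 < sin (x / 2).
Proof. by move=> /andP[x0 x2]; apply: sin_gt0_pi; apply/andP; split; lra. Qed.

(** The product form shows the sign of [step - 1/2]: on (0, 2 pi) the first sine is positive and the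
    second has the sign of [b - x]. *)
Let stepE (b x : R) :
  step (b / 2) x = 2^-1 - 2^-1 * sin (x / 2) * sin ((b - x) / 2).
Proof.
rewrite /step.
have -> : x - b / 2 = x / 2 - (b - x) / 2 by field.
have -> : b / 2 = x / 2 + (b - x) / 2 by field.
by rewrite cosB cosD; field.
Qed.

Let step_itv (h x : R) : 0 <= step h x <= 1.
Proof.
rewrite /step; have := cos_le1 h; have := cos_geN1 h.
by have := cos_le1 (x - h); have := cos_geN1 (x - h); lra.
Qed.

Let step_lt (b x : R) : 0 < b < 2 * pi -> 0 < x < b -> step (b / 2) x < 2^-1.
Proof.
move=> /andP[b0 b2] /andP[x0 xb]; rewrite stepE.
have s1 : 0 < sin (x / 2) by apply: sin_half_gt0; lra.
have s2 : 0 < sin ((b - x) / 2) by apply: sin_half_gt0; lra.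
by have := mulr_gt0 s1 s2; lra.
Qed.

Let step_gt (b x : R) : 0 < b < 2 * pi -> b < x < 2 * pi -> 2^-1 < step (b / 2) x.
Proof.
move=> /andP[b0 b2] /andP[xb x2]; rewrite stepE.
have s1 : 0 < sin (x / 2) by apply: sin_half_gt0; lra.
have s2 : 0 < sin ((x - b) / 2) by apply: sin_half_gt0; lra.
rewrite (_ : (b - x) / 2 = - ((x - b) / 2)); last by field.
by rewrite sinN; have := mulr_gt0 s1 s2; lra.
Qed.

Lemma ae_neq (a : R) : {ae mu, forall x, x != a}.
Proof.
exists [set a]; split; first exact: measurable_set1.
  exact: lebesgue_measure_set1.
by move=> x /= /negP/negPn/eqP.
Qed.

(** Dominated convergence with majorant [|g|]: the integrals of [g] times [switch] are all 0 and
    tend to the integral of [g] over [0, b]. *)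
Lemma null_Rintegral (b : R) : null_multiplier g (cst 1) -> 0 < b < 2 * pi ->
  \int[mu]_(x in `[0, b]) g x = 0.
Proof.
move=> n1 b2pi; have /andP[b0 b2] := b2pi.
pose f_ (n : nat) (x : R) : \bar R := (g x * switch n (step (b / 2) x))%:E.
pose f (x : R) : \bar R := ((g \_ `[0, b]%classic) x)%:E.
have mg : measurable_fun D g by case/integrableP : ig => /measurable_EFinP.
have mf_ n : measurable_fun D (f_ n).
  apply/measurable_EFinP; apply: measurable_funM => //.
  by have [mp _ _] := null_multiplier_switch (b / 2) n n1; exact: measurable_funTS.
have mf : measurable_fun D f.
  apply/measurable_EFinP; apply/measurable_restrict => //.
  exact: measurable_funS mg.
have f_f : {ae mu, forall x, D x -> f_ ^~ x @ \oo --> f x}.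
  have FF := ae_filter_ringOfSetsType mu.
  (* At 0, [b] and 2 pi, [step] equals 1/2 and [switch] tends to 1/e, so these points are
     discarded. *)
  apply: filterS3 (ae_neq 0) (ae_neq b) (ae_neq (2 * pi)).
  move=> x x0 xb x2 /=; rewrite in_itv/= => /andP[x0' x2'].
  have {x0 x0'}x0 : 0 < x by rewrite lt_neqAle eq_sym x0.
  have {x2 x2'}x2 : x < 2 * pi by rewrite lt_neqAle x2.
  apply: cvg_EFin; first exact: nearW.
  have [xb'|bx|xb'] := ltgtP x b; last by rewrite xb' eqxx in xb.
  - rewrite patchE mem_set/=; last by rewrite in_itv/= !ltW.
    rewrite -[X in _ --> X]mulr1; apply: cvgM; first exact: cvg_cst.
    apply: cvg_switch1.
    have /andP[-> _] := step_itv (b / 2) x.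
    by apply: step_lt => //; rewrite x0.
  - rewrite patchE memNset/=; last first.
      by rewrite in_itv/= => /andP[_]; rewrite leNgt bx.
    rewrite -[X in _ --> X](mulr0 (g x)); apply: cvgM; first exact: cvg_cst.
    apply: cvg_switch0.
    have /andP[_ ->] := step_itv (b / 2) x; rewrite andbT.
    by apply: step_gt => //; rewrite bx.
have f_g : {ae mu, forall x n, D x -> (`|f_ n x| <= (abse \o (EFin \o g)) x)%E}.
  apply: aeW => x n _; rewrite lee_fin normrM ler_piMr//.
  by have /andP[p0 p1] := switch_itv n (step_itv (b / 2) x); rewrite ger0_norm.
have [_ _] := @dominated_convergence _ _ _ mu D (measurable_itv _) _ _ _
                mf_ mf f_f (integrable_abse ig) f_g.
rewrite [X in X @ _](_ : _ = cst 0%E); last first.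
  apply/funext => n.
  have [mp [M pM] p0] := null_multiplier_switch (b / 2) n n1.
  have int0 : \int[mu]_(x in D) (g x * switch n (step (b / 2) x)) = 0.
    rewrite -[RHS](p0 0 0); apply: eq_Rintegral => x _.
    by rewrite mul0r addr0 cos0 mulr1.
  rewrite -[LHS]fineK; first exact: (congr1 EFin int0).
  by apply: integrable_fin_num => //; exact: integrable_mul_bounded ig mp pM.
move/(cvg_unique _ (cvg_cst 0%E)) => /(_ (@ereal_hausdorff R)) /(congr1 fine)/=.
rewrite -[fine _]/(\int[mu]_(x in D) (g \_ `[0, b]%classic) x).
rewrite -Rintegral_mkcondr => /esym.
rewrite (_ : D `&` `[0, b] = `[0, b]%classic); first by move=> ->.
rewrite setIidr// => x /=; rewrite !in_itv/= => /andP[-> xb].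
by rewrite (le_trans xb)// ltW.
Qed.

(** The primitive of [g] vanishes on (0, 2 pi), and its derivative is [g] almost everywhere. *)
Lemma null_ae_eq0 : null_multiplier g (cst 1) ->
  {ae mu, forall x, 0 < x < 2 * pi -> g x = 0}.
Proof.
move=> n1.
(* Extension by zero makes [g] integrable on every [0, y], including y > 2 pi, as [FTC1] asks. *)
have ig' : mu.-integrable setT (EFin \o (g \_ D)).
  rewrite -restrict_EFin.
  exact: (@integrable_mkcond _ _ _ mu D _ (measurable_itv _)).1 ig.
have iy y :
    mu.-integrable [set` Interval (BLeft 0) (BRight y)] (EFin \o (g \_ D)).
  exact: integrableS ig'.
have := FTC1 iy (integrable_locally (measurable_itv _) ig).
apply: filterS; first exact: (ae_filter_ringOfSetsType mu).
move=> x + /andP[x0 x2]; rewrite lte_fin => /(_ x0)[_].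
rewrite patchE mem_set/=; last by rewrite in_itv/= !ltW.
move=> <-.
rewrite derive1E (near_eq_derive (g := cst 0)) ?derive_cst// ?oner_neq0//.
near=> y.
rewrite -[RHS](@null_Rintegral y)//; last by apply/andP; split; near: y;
  [exact: lt_nbhsr|exact: lt_nbhsl].
apply: eq_Rintegral => z; rewrite inE/= in_itv/= => /andP[z0 zy].
rewrite patchE mem_set//= in_itv/= z0 (le_trans zy)//.
by near: y; exact: lt_le_nbhsl.
Unshelve. all: by end_near. Qed.

End fourier_uniqueness.

(** The pushforward under translation agrees with Lebesgue measure on the intervals ]b, c], which
    determine it. *)
Lemma lebesgue_measure_translation (R : realType) (a : R) (A : set R) :
  measurable A ->
  lebesgue_measure ((fun x => x + a) @^-1` A) = lebesgue_measure A :> \bar R.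
Proof.
move=> mA; have ma : measurable_fun setT (fun x : R => x + a).
  by apply: measurable_funD => //; exact: measurable_cst.
suff : pushforward (@lebesgue_measure R)
    ((fun x => x + a) : _ -> measurableTypeR R) A = lebesgue_measure A by [].
apply/esym/lebesgue_measure_unique => //= _ [[b c]] _ <-.
rewrite /pushforward.
have -> : (fun x => x + a) @^-1` `]b, c]%classic = `]b - a, c - a]%classic.
  by apply/seteqP; split=> x /=; rewrite !in_itv/= ltrBlDr lerBrDr.
rewrite /= !lebesgue_measure_itv/= !lte_fin ltrD2r -EFinD.
congr (if _ then _ else _).
by congr EFin; ring.
Qed.

Lemma ae_translation (R : realType) (a : R) (P : R -> Prop) :
  {ae @lebesgue_measure R, forall x, P x} ->
  {ae @lebesgue_measure R, forall x, P (x + a)}.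
Proof.
move=> [A [mA A0 PA]]; exists ((fun x => x + a) @^-1` A); split.
- by rewrite -[X in measurable X]setTI; exact: measurable_funD.
- by rewrite lebesgue_measure_translation.
- by move=> x Px; exact: PA.
Qed.

Lemma cexp_imag (R : realType) (r : R) : cexp ('i * r%:C) = cos r +i* sin r.
Proof.
have -> : 'i * r%:C = 0 +i* r :> R[i].
  by apply/eqP; rewrite eq_complex/= !mul0r !mul1r subrr add0r !eqxx.
by rewrite /cexp/= expR0 mul1r.
Qed.

(** * Complex functions in L^2 of the circle *)

Section complex_fourier_uniqueness.
Context {R : realType}.
Notation mu := (@lebesgue_measure R).
Local Notation D := (`[0, 2 * pi]%classic : set R).

(** The majorant is [1 + g ^ 2], integrable because the interval has finite measure. *)
Lemma integrable_sqr (g : R -> R) : measurable_fun setT g ->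
  (\int[mu]_(x in D) (g x ^+ 2)%:E < +oo)%E -> mu.-integrable D (EFin \o g).
Proof.
move=> mg g2.
have mg2 : measurable_fun D (fun x => g x ^+ 2).
  by apply: measurable_funTS; exact: measurable_funX.
have ig2 : mu.-integrable D (EFin \o (fun x => g x ^+ 2)).
  apply/integrableP; split; first exact/measurable_EFinP.
  by under eq_integral => x _ do rewrite /= ger0_norm ?sqr_ge0//.
have i1 : mu.-integrable D (EFin \o (cst (1 : R))).
  apply: measurable_bounded_integrable => //.
    by rewrite /= lebesgue_measure_itv/=; case: ifP => _; rewrite ?ltry.
  exists 1; split; first exact: num_real.
  by move=> M M1 x _ /=; rewrite normr1 ltW.
have i12 : mu.-integrable D (fun x => (1 + g x ^+ 2)%:E).
  exact: (integrableD _ i1 ig2).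
apply: (le_integrable _ _ _ i12) => //.
  by apply/measurable_EFinP; exact: measurable_funTS.
move=> x _ /=; rewrite lee_fin [leRHS]ger0_norm ?addr_ge0 ?sqr_ge0//.
have := sqr_ge0 (`|g x| - 1); rewrite -(real_normK (num_real (g x))).
by have := normr_ge0 (g x); nra.
Qed.

Lemma in_L2_integrable (f : R -> R[i]) : in_L2 f ->
  mu.-integrable D (EFin \o (fun x => complex.Re (f x))) /\
  mu.-integrable D (EFin \o (fun x => complex.Im (f x))).
Proof.
move=> [_ mr mi f2].
have n2 x : Normc.normc (f x) ^+ 2 = complex.Re (f x) ^+ 2 + complex.Im (f x) ^+ 2.
  by case: (f x) => a b /=; rewrite sqr_sqrtr// addr_ge0// sqr_ge0.
have mn : measurable_fun D (fun x => (Normc.normc (f x) ^+ 2)%:E).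
  apply/measurable_EFinP; apply: measurable_funTS.
  under eq_fun do rewrite n2.
  by apply: measurable_funD; exact: measurable_funX.
split; apply: integrable_sqr => //; apply: le_lt_trans f2.
all: apply: ge0_le_integral => //; try by move=> x _; rewrite lee_fin sqr_ge0.
1,3: by apply/measurable_EFinP; apply: measurable_funTS; exact: measurable_funX.
all: by move=> x _; rewrite lee_fin n2 ?lerDl ?lerDr sqr_ge0.
Qed.

Lemma fourier_eq0 (f : R -> R[i]) (k : int) : fourier f k = 0 ->
  let u x := complex.Re (f x) in let v x := complex.Im (f x) in
  \int[mu]_(x in D) (u x * cos (k%:~R * x) + v x * sin (k%:~R * x)) = 0 /\
  \int[mu]_(x in D) (v x * cos (k%:~R * x) - u x * sin (k%:~R * x)) = 0.
Proof.
move=> fk0 u v.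
have prodE x : f x * cexp (- ('i * k%:~R * x%:C)) =
    (u x * cos (k%:~R * x) + v x * sin (k%:~R * x)) +i*
    (v x * cos (k%:~R * x) - u x * sin (k%:~R * x)).
  rewrite -(rmorph_int (real_complex R)) -mulrA -rmorphM -mulrN -rmorphN.
  rewrite cexp_imag cosN sinN /u /v; case: (f x) => a b.
  by apply/eqP; rewrite eq_complex/=; apply/andP; split; apply/eqP; ring.
have : circle_integral (fun x => f x * cexp (- ('i * k%:~R * x%:C))) = 0.
  move: fk0; rewrite /fourier => /eqP; rewrite mulf_eq0 => /orP[|/eqP//].
  rewrite -(rmorph0 (real_complex R)) => /eqP/complexI/eqP.
  by rewrite invr_eq0 mulf_eq0 pnatr_eq0/= gt_eqF// pi_gt0.
rewrite /circle_integral => -[re0 im0].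
split; [rewrite -[RHS]re0|rewrite -[RHS]im0].
all: by apply: eq_Rintegral => x _; rewrite prodE.
Qed.

(** Each coefficient couples the integrals of the real and imaginary parts. Passing from [k] to [-k]
    flips the sign of the sine integrals only, so the two indices together give four equations that
    force all four integrals to vanish. *)
Lemma fourier_null_multiplier (f : R -> R[i]) : in_L2 f ->
  (forall k, fourier f k = 0) ->
  null_multiplier (fun x => complex.Re (f x)) (cst 1) /\
  null_multiplier (fun x => complex.Im (f x)) (cst 1).
Proof.
move=> /in_L2_integrable; set u := fun x => complex.Re (f x).
set v := fun x => complex.Im (f x) => -[iu iv] f0.
have mc (k : int) : measurable_fun setT (fun x : R => cos (k%:~R * x)).
  by have := measurable_cos_affine (k%:~R : R) 0; under eq_fun do rewrite addr0.
have ms (k : int) : measurable_fun setT (fun x : R => sin (k%:~R * x)).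
  have := measurable_cos_affine (k%:~R : R) (- (pi / 2)).
  by under eq_fun do rewrite cosBpihalf.
have icos g (k : int) : mu.-integrable D (EFin \o g) ->
    mu.-integrable D (EFin \o (fun x => g x * cos (k%:~R * x))).
  by move=> ig; apply: (@integrable_mul_bounded _ _ _ _ 1) => // x; exact: cos_max.
have isin g (k : int) : mu.-integrable D (EFin \o g) ->
    mu.-integrable D (EFin \o (fun x => g x * sin (k%:~R * x))).
  by move=> ig; apply: (@integrable_mul_bounded _ _ _ _ 1) => // x; exact: sin_max.
pose C g (k : int) := \int[mu]_(x in D) (g x * cos (k%:~R * x)).
pose S g (k : int) := \int[mu]_(x in D) (g x * sin (k%:~R * x)).
have CN g k : C g (- k) = C g k.
  by apply: eq_Rintegral => x _; rewrite rmorphN mulNr cosN.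
have SN g k : mu.-integrable D (EFin \o g) -> S g (- k) = - S g k.
  move=> ig; rewrite -[RHS]mulN1r -RintegralZl//; last exact: isin.
  by apply: eq_Rintegral => x _; rewrite rmorphN mulNr sinN mulrN mulN1r.
have CS k : C u k + S v k = 0 /\ C v k - S u k = 0.
  have [h1 h2] := fourier_eq0 (f0 k).
  by split; [rewrite -[RHS]h1 RintegralD//|rewrite -[RHS]h2 RintegralB//];
    first [exact: icos|exact: isin].
have main g : mu.-integrable D (EFin \o g) -> (forall k, C g k = 0) ->
    (forall k, S g k = 0) -> null_multiplier g (cst 1).
  move=> ig C0 S0; split; first exact: measurable_cst.
    by exists 1 => x; rewrite normr1.
  move=> k phi.
  have -> : \int[mu]_(x in D) (g x * cst 1 x * cos (k%:~R * x + phi)) =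
      \int[mu]_(x in D) (cos phi * (g x * cos (k%:~R * x)) -
                         sin phi * (g x * sin (k%:~R * x))).
    by apply: eq_Rintegral => x _; rewrite cosD /cst; ring.
  rewrite RintegralB//; last 2 first.
    exact: (integrableZl _ _ (icos _ _ ig)).
    exact: (integrableZl _ _ (isin _ _ ig)).
  rewrite !RintegralZl//; [|exact: isin|exact: icos].
  by rewrite -/(C g k) -/(S g k) C0 S0 !mulr0 subr0.
have uv k : [/\ C u k = 0, S u k = 0, C v k = 0 & S v k = 0].
  have [h1 h2] := CS k; have [] := CS (- k).
  by rewrite !CN !SN// => h3 h4; split; lra.
by split; apply: main => // k; have [] := uv k.
Qed.

Lemma fourier_uniqueness (f : R -> R[i]) : in_L2 f ->
  (forall k, fourier f k = 0) -> {ae mu, forall x, f x = 0}.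
Proof.
move=> fL2 f0; have [pf _ _ _] := fL2.
have [iu iv] := in_L2_integrable fL2.
have [nu nv] := fourier_null_multiplier fL2 f0.
have FF := ae_filter_ringOfSetsType mu.
have ae0 : {ae mu, forall x, 0 < x < 2 * pi -> f x = 0}.
  apply: filterS2 (null_ae_eq0 iu nu) (null_ae_eq0 iv nv) => x hu hv x02.
  by move: (hu x02) (hv x02); case: (f x) => a b /= -> ->.
have pn (n : nat) x : f (x + 2 * pi * n%:R) = f x.
  elim: n x => [|n IH] x; first by rewrite mulr0 addr0.
  by rewrite -[n.+1%:R]natr1 mulrDr mulr1 addrA pf IH.
have pz (m : int) x : f (x + 2 * pi * m%:~R) = f x.
  case: m => n; first exact: pn.
  by rewrite NegzE -(pn n.+1) mulrNz mulrN subrK.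
have aem (m : int) :
    {ae mu, forall x, 0 < x + 2 * pi * m%:~R < 2 * pi -> f x = 0}.
  apply: filterS (ae_translation (2 * pi * m%:~R) ae0) => x h xm.
  by rewrite -(pz m) h.
have aen (m : int) : {ae mu, forall x, x != 2 * pi * m%:~R} by exact: ae_neq.
(* Periodicity carries the result to every translate of (0, 2 pi). The integers are split by sign
   because [ae_foralln] ranges over naturals. *)
have ae1 : {ae mu, forall x, forall n : nat,
    (0 < x + 2 * pi * n%:Z%:~R < 2 * pi -> f x = 0)}.
  by apply: ae_foralln => n; exact: aem.
have ae2 : {ae mu, forall x, forall n : nat,
    (0 < x + 2 * pi * (- n%:Z)%:~R < 2 * pi -> f x = 0)}.
  by apply: ae_foralln => n; exact: aem.
have ae3 : {ae mu, forall x, forall n : nat, x != 2 * pi * n%:Z%:~R}.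
  by apply: ae_foralln => n; exact: aen.
have ae4 : {ae mu, forall x, forall n : nat, x != 2 * pi * (- n%:Z)%:~R}.
  by apply: ae_foralln => n; exact: aen.
apply: filterS2 (filterI ae1 ae2) (filterI ae3 ae4) => x [h1 h2] [h3 h4].
have pi2 : 0 < 2 * pi :> R by rewrite mulr_gt0// pi_gt0.
pose m := Num.floor (x / (2 * pi)).
have := floor_le (x / (2 * pi)); have := floorD1_gt (x / (2 * pi)).
rewrite -/m ltr_pdivrMr// ler_pdivlMr// intrD => mx xm.
have xNm : x != 2 * pi * m%:~R.
  case: (m) => n; first exact: h3.
  by rewrite NegzE; exact: h4.
have {xm}xm : m%:~R * (2 * pi) < x by rewrite lt_neqAle xm mulrC eq_sym xNm.
have : 0 < x + 2 * pi * (- m)%:~R < 2 * pi.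
  by rewrite mulrNz mulrN subr_gt0 ltrBlDr [_ * m%:~R]mulrC xm/=; lra.
case: (m) => n; first exact: h2.
by rewrite NegzE opprK; exact: h1.
Qed.

End complex_fourier_uniqueness.

(** * Symmetric series over the integers *)

(** These are the partial sums of [zseries], over [-N <= k <= N]. *)
Definition symsum (V : nmodType) (a : int -> V) (N : nat) : V :=
  \sum_(j < (2 * N).+1) a (j%:Z - N%:Z).

Lemma symsum0 (V : nmodType) (a : int -> V) : symsum a 0 = a 0.
Proof. by rewrite /symsum big_ord1. Qed.

Lemma symsumS (V : nmodType) (a : int -> V) (N : nat) :
  symsum a N.+1 = symsum a N + (a N.+1%:Z + a (- N.+1%:Z)).
Proof.
rewrite /symsum (_ : (2 * N.+1).+1 = (2 * N).+1.+2); last by lia.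
rewrite big_ord_recl big_ord_recr/=.
rewrite (eq_bigr (fun i : 'I_(2 * N).+1 => a (i%:Z - N%:Z))); last first.
  by move=> i _; congr (a _); rewrite /bump /=; lia.
have -> : (bump 0 (2 * N).+1)%:Z - N.+1%:Z = N.+1%:Z by rewrite /bump/=; lia.
by rewrite sub0r addrC -addrA.
Qed.

Lemma symsumD (V : nmodType) (a b : int -> V) N :
  symsum (fun k => a k + b k) N = symsum a N + symsum b N.
Proof. exact: big_split. Qed.

Lemma symsumZ (K : pzRingType) (c : K) (a : int -> K) N :
  symsum (fun k => c * a k) N = c * symsum a N.
Proof. by rewrite /symsum mulr_sumr. Qed.

Lemma symsumB (V : zmodType) (a b : int -> V) N :
  symsum (fun k => a k - b k) N = symsum a N - symsum b N.
Proof. exact: sumrB. Qed.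

Lemma symsum_delta (V : nmodType) (j : int) (x : V) (N : nat) :
  symsum (fun k => if k == j then x else 0) N = if (`|j| <= N)%N then x else 0.
Proof.
elim: N => [|N IH].
  by rewrite symsum0 leqn0 absz_eq0 eq_sym.
rewrite symsumS {}IH; have [jN|Nj] := leqP `|j| N.
  rewrite leqW//; have -> : (N.+1%:Z == j) = false by apply/negP => /eqP h; lia.
  have -> : (- N.+1%:Z == j) = false by apply/negP => /eqP h; lia.
  by rewrite !addr0.
rewrite add0r; case: eqVneq => [h|h1].
  have -> : (- N.+1%:Z == j) = false by apply/negP => /eqP h'; lia.
  by rewrite -h absz_nat leqnn addr0.
case: eqVneq => [h|h2]; first by rewrite -h abszN absz_nat leqnn add0r.
have -> : (`|j| <= N.+1)%N = false by lia.
by rewrite addr0.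
Qed.

Section symmetric_series.
Context {R : realType}.
Implicit Types a b : int -> R.

Lemma symsum_nondecreasing a : (forall k, 0 <= a k) ->
  nondecreasing_seq (symsum a).
Proof.
by move=> a0; apply/nondecreasing_seqP => N; rewrite symsumS lerDl addr_ge0.
Qed.

Lemma symsum_is_cvg a (M : R) : (forall k, 0 <= a k) ->
  (forall N : nat, \sum_(0 <= n < N) a n%:Z <= M) ->
  (forall N : nat, \sum_(0 <= n < N) a (- n%:Z) <= M) ->
  cvgn (symsum a).
Proof.
move=> a0 aP aN; apply: nondecreasing_is_cvgn; first exact: symsum_nondecreasing.
exists (M + M) => _ [N _ <-]; apply: le_trans (lerD (aP N.+1) (aN N.+1)).
(* The index 0 occurs in both one-sided sums, which only enlarges the bound. *)
elim: N => [|N IH]; first by rewrite symsum0 !big_nat1 oppr0 lerDl.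
rewrite symsumS [in leRHS]big_nat_recr//= [X in _ <= _ + X]big_nat_recr//=.
by rewrite addrACA lerD2r.
Qed.

(** The terms [a + b] lie between 0 and [2 * b], so their sums converge monotonically; then [b] is
    subtracted. *)
Lemma symsum_dominated_is_cvg a b : (forall k, `|a k| <= b k) ->
  cvgn (symsum b) -> cvgn (symsum a).
Proof.
move=> ab cb.
have b0 k : 0 <= b k by exact: le_trans (ab k).
have abD : forall N, symsum (fun k => a k + b k) N = symsum a N + symsum b N.
  exact: symsumD.
have -> : symsum a = (fun N => symsum (fun k => a k + b k) N - symsum b N).
  by apply/funext => N; rewrite abD addrK.
apply: is_cvgB => //; apply: nondecreasing_is_cvgn.
  apply: symsum_nondecreasing => k.
  by have := ab k; rewrite ler_norml => /andP[]; lra.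
exists (2 * limn (symsum b)) => _ [N _ <-]; rewrite abD.
have := nondecreasing_cvgn_le (symsum_nondecreasing b0) cb N.
suff : symsum a N <= symsum b N by lra.
by apply: ler_sum => i _; exact: le_trans (ler_norm _) _.
Qed.

(** As the full sum of [a n] is 0, its partial sum up to [N] is minus a tail, bounded by the tail of
    [b] uniformly in [n]. This bound passes to [l], and then [N] grows. *)
Lemma symsum_dominated_cvg0 (a : nat -> int -> R) (l b : int -> R) :
  (forall n k, `|a n k| <= b k) -> cvgn (symsum b) ->
  (forall k, a n k @[n --> \oo] --> l k) ->
  (forall n, symsum (a n) @ \oo --> (0 : R)) ->
  symsum l @ \oo --> (0 : R).
Proof.
move=> ab cb al a0; set L := limn (symsum b).
have tail n N : `|symsum (a n) N| <= L - symsum b N.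
  have main (c : int -> R) : (forall k, `|c k| <= b k) ->
      symsum c @ \oo --> (0 : R) -> symsum c N <= L - symsum b N.
    move=> cb' c0.
    have cD : symsum (fun k => b k + c k) @ \oo --> L.
      by rewrite -[L]addr0 (funext (symsumD b c)); exact: cvgD.
    have nd : nondecreasing_seq (symsum (fun k => b k + c k)).
      apply: symsum_nondecreasing => k.
      by have := cb' k; rewrite ler_norml => /andP[]; lra.
    have := nondecreasing_cvgn_le nd (cvgP _ cD) N.
    by rewrite (cvg_lim _ cD)// symsumD lerBrDl.
  rewrite ler_norml main// andbT lerNl -mulN1r -symsumZ main//.
    by move=> k; rewrite mulN1r normrN.
  rewrite (funext (symsumZ (-1) (a n))).
  by rewrite -[X in _ --> X](mulr0 (-1)); apply: cvgM => //; exact: cvg_cst.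
have ltail N : `|symsum l N| <= L - symsum b N.
  have cl : `|symsum (a n) N| @[n --> \oo] --> `|symsum l N|.
    by apply: cvg_norm; apply: cvg_big => [|i _]; [exact: add_continuous|exact: al].
  by apply: cvgr_to_le cl _; exact: nearW.
apply/norm_cvg0P.
apply: (@squeeze_cvgr _ _ _ _ (cst 0) (fun N => L - symsum b N)).
- by apply: nearW => N; rewrite normr_ge0 ltail.
- exact: cvg_cst.
- by rewrite -[X in _ --> X](subrr L); apply: cvgB => //; exact: cvg_cst.
Qed.

Lemma ler_norm_sin (x : R) : `|sin x| <= `|x|.
Proof.
wlog x0 : x / 0 <= x.
  move=> h; have [|x0] := leP 0 x; first exact: h.
  by rewrite -normrN -sinN -[leRHS]normrN h// oppr_ge0 ltW.
have [|c _] := @MVT_segment R sin cos 0 x x0 (fun y _ => is_derive_sin y).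
  by apply: continuous_subspaceT => y; exact: continuous_sin.
by rewrite sin0 !subr0 => ->; rewrite normrM ler_piMl// cos_max.
Qed.

Lemma cvg_sin_div (u : nat -> R) : (forall n, u n != 0) ->
  u @ \oo --> (0 : R) -> sin (u n) / u n @[n --> \oo] --> (1 : R).
Proof.
move=> u0 cu.
have cu' : u @ \oo --> (0 : R)^'.
  move=> P /cu uP; suff : \forall n \near \oo, P (u n) by [].
  have : \forall n \near \oo, u n != 0 -> P (u n) by exact: uP.
  by apply: filterS => n /(_ (u0 n)).
have ds : h^-1 * sin h @[h --> (0 : R)^'] --> (1 : R).
  have dsin := is_derive_sin (0 : R).
  have := @ex_derive _ _ _ _ _ _ _ dsin.
  have := @derive_val _ _ _ _ _ _ _ dsin; rewrite cos0 => /= d1 dv.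
  move/cvg_ex: dv => [l dl].
  have l1 : l = 1 by rewrite -[RHS]d1; apply/esym; exact: cvg_lim dl.
  rewrite l1 in dl; move: dl; apply: cvg_trans; apply: near_eq_cvg; near=> h.
  by rewrite /= addr0 sin0 subr0 /GRing.scale/= mulr1.
under eq_fun do rewrite mulrC.
exact: (cvg_comp _ _ cu' ds).
Unshelve. all: by end_near. Qed.

Lemma cvg_sin_mul_div (c : R) (u : nat -> R) : (forall n, u n != 0) ->
  u @ \oo --> (0 : R) -> sin (c * u n) / u n @[n --> \oo] --> c.
Proof.
move=> u0 cu; have [->|c0] := eqVneq c 0.
  by under eq_fun do rewrite mul0r sin0 mul0r; exact: cvg_cst.
have cn0 n : c * u n != 0 by rewrite mulf_neq0.
have : c * u n @[n --> \oo] --> (0 : R).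
  by rewrite -[X in _ --> X](mulr0 c); apply: cvgM => //; exact: cvg_cst.
move/(cvg_sin_div cn0) => h.
rewrite -[X in _ --> X]mulr1.
rewrite (_ : (fun n => _) = (fun n => c * (sin (c * u n) / (c * u n)))).
  by apply: cvgM => //; exact: cvg_cst.
by apply/funext => n; field; rewrite c0 u0.
Qed.

(** * Almost periodic sums that vanish on an interval *)

Section almost_periodic.
Variables (T : R) (nu A B b : int -> R).
Hypotheses (nu1 : forall k, `|nu k| <= 1) (cb : cvgn (symsum b)).
Hypothesis ABb : forall k, `|A k| + `|B k| <= b k.

(** The real part of [(A k + i B k) e^(i nu_k s)]. *)
Let g (k : int) (s : R) : R := A k * cos (nu k * s) - B k * sin (nu k * s).

(** These multipliers form a linear space. Among those bounded by 1, it is closed under pointwise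
    limits and multiplication by [nu ^ 2]; this leads from the constant 1 to the indicator of
    [j]. *)
Let null (phi : int -> R) : Prop :=
  forall s, 0 < s < T -> symsum (fun k => phi k * g k s) @ \oo --> (0 : R).

Let gb k s : `|g k s| <= b k.
Proof.
apply: le_trans (ABb k); apply: le_trans (ler_normB _ _) _.
by rewrite !normrM lerD// ler_piMr// ?cos_max ?sin_max.
Qed.

Let nullD (phi psi : int -> R) (c d : R) : null phi -> null psi ->
  null (fun k => c * phi k + d * psi k).
Proof.
move=> h1 h2 s sT.
have -> : symsum (fun k => (c * phi k + d * psi k) * g k s) =
    (fun N => c * symsum (fun k => phi k * g k s) N +
              d * symsum (fun k => psi k * g k s) N).
  apply/funext => N; rewrite -!symsumZ -symsumD; congr (symsum _ N).
  by apply/funext => k; ring.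
rewrite -[X in _ --> X](addr0 (0 : R)) -[in X in _ --> X + _](mulr0 c).
rewrite -[in X in _ --> _ + X](mulr0 d).
by apply: cvgD; (apply: cvgM; [exact: cvg_cst|]); [exact: h1|exact: h2].
Qed.

Let null_lim (f : nat -> int -> R) (phi : int -> R) :
  (forall n k, `|f n k| <= 1) -> (forall k, f n k @[n --> \oo] --> phi k) ->
  (forall n, null (f n)) -> null phi.
Proof.
move=> f1 cf nf s sT.
apply: (@symsum_dominated_cvg0 (fun n k => f n k * g k s) _ b) => //.
- move=> n k; rewrite normrM -[leRHS]mul1r ler_pM//.
- by move=> k; apply: cvgM => //; exact: cvg_cst.
- by move=> n; exact: nf.
Qed.

(* Second differences in time approximate the second derivative, which
   multiplies the [k]-th term by [- nu k ^+ 2]. *)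
Let null_sqr (phi : int -> R) : (forall k, `|phi k| <= 1) -> null phi ->
  null (fun k => phi k * nu k ^+ 2).
Proof.
move=> phi1 nphi s /andP[s0 sT].
(* With [h n <= d], the times [s + 2 * h n] and [s - 2 * h n] stay in (0, T). *)
have [d d0 ds] : exists2 d, 0 < d & 2 * d < s /\ s + 2 * d < T.
  exists (Num.min s (T - s) / 4).
    by rewrite divr_gt0// lt_min s0 subr_gt0.
  have : Num.min s (T - s) <= s by rewrite ge_min lexx.
  have : Num.min s (T - s) <= T - s by rewrite ge_min lexx orbT.
  by split; lra.
pose h (n : nat) : R := d * n.+1%:R^-1.
have h0 n : 0 < h n by rewrite mulr_gt0// invr_gt0.
have hd n : h n <= d by rewrite /h ler_piMr ?(ltW d0)// invf_le1// ler1n.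
have ch : h @ \oo --> (0 : R).
  rewrite -[X in _ --> X](mulr0 d); apply: cvgM; first exact: cvg_cst.
  exact: cvg_harmonic.
pose q n k := sin (nu k * h n) / h n.
have q1 n k : `|q n k| <= 1.
  rewrite normrM normfV ler_pdivrMr ?normr_gt0 ?gt_eqF// mul1r.
  by apply: le_trans (ler_norm_sin _) _; rewrite normrM ler_piMl.
(* With increment [2 * h], the second difference is exactly [- 4 sin(nu h)^2] times [g]. Hence the
   multiplier is [q ^ 2], which is bounded by 1 uniformly in [n] and tends to [nu ^ 2]. *)
have qE n k : q n k ^+ 2 * g k s =
    - (4^-1 * (h n)^-2) * (g k (s + 2 * h n) + g k (s - 2 * h n) - 2 * g k s).
  rewrite /q /g !mulrDr !mulrN !cosD !sinD !cosN !sinN.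
  have -> : nu k * (2 * h n) = nu k * h n + nu k * h n by ring.
  rewrite !cosD !sinD -!expr2 cos2sin2.
  by field; rewrite gt_eqF.
apply: (@symsum_dominated_cvg0 (fun n k => phi k * (q n k ^+ 2 * g k s)) _ b) => //.
- move=> n k; rewrite normrM -[leRHS]mul1r ler_pM//.
  by rewrite normrM -[leRHS]mul1r ler_pM// normrX exprn_ile1.
- move=> k; rewrite -mulrA; apply: cvgM; first exact: cvg_cst.
  apply: cvgM; last exact: cvg_cst.
  rewrite expr2; under eq_fun do rewrite expr2.
  by apply: cvgM; apply: cvg_sin_mul_div => // n; rewrite gt_eqF.
- move=> n.
  have -> : symsum (fun k => phi k * (q n k ^+ 2 * g k s)) = (fun N =>
      - (4^-1 * (h n)^-2) * (symsum (fun k => phi k * g k (s + 2 * h n)) N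
        + symsum (fun k => phi k * g k (s - 2 * h n)) N
        - 2 * symsum (fun k => phi k * g k s) N)).
    apply/funext => N; rewrite -symsumZ -symsumD -symsumB -symsumZ.
    by congr (symsum _ N); apply/funext => k; rewrite qE; ring.
  have := hd n; have := h0 n => hn0 hnd; case: ds => ds1 ds2.
  rewrite -[X in _ --> X](mulr0 (- (4^-1 * (h n)^-2))).
  apply: cvgM; first exact: cvg_cst.
  rewrite -[X in _ --> X](subrr (0 : R)); apply: cvgB.
    rewrite -[X in _ --> X](addr0 (0 : R)).
    by apply: cvgD; apply: nphi; apply/andP; split; lra.
  rewrite -[X in _ --> X](mulr0 2); apply: cvgM; first exact: cvg_cst.
  by apply: nphi; rewrite s0.
Qed.

Lemma almost_periodic_coef0 (j : int) : 0 < T ->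
  (forall s, 0 < s < T -> symsum (fun k => g k s) @ \oo --> (0 : R)) ->
  (forall k, (nu k == 0) = (k == j)) -> A j = 0.
Proof.
move=> T0 g0 nuj.
have nu01 k : 0 <= 1 - nu k ^+ 2 <= 1.
  by rewrite gerBl sqr_ge0 subr_ge0 -real_normK ?num_real// exprn_ile1.
pose f (n : nat) k := (1 - nu k ^+ 2) ^+ n.
have f1 n k : `|f n k| <= 1.
  have /andP[? ?] := nu01 k.
  by rewrite ger0_norm ?exprn_ge0// exprn_ile1.
have nf n : null (f n).
  elim: n => [|n IH].
    by move=> s sT; under [X in symsum X]eq_fun do rewrite /f expr0 mul1r; exact: g0.
  have := nullD 1 (-1) IH (null_sqr (f1 n) IH).
  congr null; apply/funext => k; rewrite /f (exprS _ n); ring.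
pose phi k : R := (k == j)%:R.
have nphi : null phi.
  apply: (null_lim f1) nf => k; rewrite /phi -nuj.
  have [nu0|nu0] := eqVneq (nu k) 0.
    by rewrite /f nu0; under eq_fun do rewrite expr0n/= subr0 expr1n; exact: cvg_cst.
  apply: cvg_expr; have /andP[? ?] := nu01 k.
  by rewrite ger0_norm// ltrBlDr ltrDl exprn_even_gt0.
(* Any time in (0, T) would do: [nu j = 0] makes the remaining term constant. *)
have T2 : 0 < T / 2 < T by rewrite divr_gt0//= ltr_pdivrMr//; lra.
have cA : symsum (fun k => phi k * g k (T / 2)) @ \oo --> A j.
  apply: cvg_near_cst; exists `|j|%N => // N /= jN.
  under [X in symsum X]eq_fun => k.
    have -> : phi k * g k (T / 2) = if k == j then A j else 0.
      rewrite /phi; case: eqVneq => [->|_]; last by rewrite mul0r.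
      have /eqP nuj0 : nu j == 0 by rewrite nuj.
      by rewrite /g nuj0 mul0r cos0 sin0 mulr1 mulr0 subr0 mul1r.
    over.
  by rewrite symsum_delta jN.
exact: (cvg_unique _ cA (nphi _ T2)).
Qed.

End almost_periodic.
End symmetric_series.

(** * The linear equation *)

(** Telescoping: [1 / (1 + n^2)] is at most [4 / (n + 1) - 4 / (n + 2)]. *)
Lemma sum_inv_sqr_le (R : realFieldType) (N : nat) :
  \sum_(0 <= n < N) (1 + n%:R ^+ 2)^-1 <= 4 :> R.
Proof.
suff : \sum_(0 <= n < N) (1 + n%:R ^+ 2)^-1 <= 4 - 4 / N.+1%:R :> R.
  by move=> /le_trans; apply; rewrite gerBl divr_ge0.
elim: N => [|N IH]; first by rewrite big_nil divr1 subrr.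
rewrite big_nat_recr//=; apply: le_trans (lerD IH (lexx _)) _.
rewrite -[N.+2%:R]natr1 -[N.+1%:R]natr1; have := ler0n R N.
move: (N%:R : R) => x x0.
rewrite -subr_ge0.
have -> : 4 - 4 / (x + 1 + 1) - (4 - 4 / (x + 1) + (1 + x ^+ 2)^-1) =
    (3 * x ^+ 2 - 3 * x + 2) / ((x + 1 + 1) * (x + 1) * (1 + x ^+ 2)).
  by field; apply/and3P; split; nra.
by apply: divr_ge0; [nra|rewrite !mulr_ge0//; nra].
Qed.

(** With weight [w], a completed square gives [a <= w * a ^ 2 + 1 / w] termwise; this takes the
    place of Cauchy-Schwarz. *)
Lemma sum_le_weighted_sqr (R : realFieldType) (a : nat -> R) (M : R) (N : nat) :
  \sum_(0 <= n < N) (1 + n%:R ^+ 2) * a n ^+ 2 <= M ->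
  \sum_(0 <= n < N) a n <= M + 4.
Proof.
move=> aM; apply: le_trans (lerD aM (sum_inv_sqr_le R N)).
rewrite -big_split/=; apply: ler_sum => n _.
have w0 : 0 < 1 + n%:R ^+ 2 :> R by rewrite ltr_pwDl// sqr_ge0.
have w1 : 0 < (1 + n%:R ^+ 2)^-1 :> R by rewrite invr_gt0.
have ww : (1 + n%:R ^+ 2) * (1 + n%:R ^+ 2)^-1 = 1 :> R by rewrite mulfV// gt_eqF.
move: w0 w1 ww; set w := 1 + _; set v := w^-1 => w0 w1 ww.
have : 0 <= v * (w * a n - 1) ^+ 2 by rewrite mulr_ge0 ?sqr_ge0// ltW.
have -> : v * (w * a n - 1) ^+ 2 =
    (w * v) * w * a n ^+ 2 - 2 * (w * v) * a n + v by ring.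
rewrite ww => h1.
have : 0 <= w * a n ^+ 2 by rewrite mulr_ge0 ?sqr_ge0// ltW.
by lra.
Qed.

Lemma normc_Re (R : rcfType) (z : R[i]) : `|complex.Re z| <= Normc.normc z.
Proof. by case: z => a b /=; rewrite -sqrtr_sqr ler_wsqrtr// lerDl sqr_ge0. Qed.

Lemma normc_Im (R : rcfType) (z : R[i]) : `|complex.Im z| <= Normc.normc z.
Proof. by case: z => a b /=; rewrite -sqrtr_sqr ler_wsqrtr// lerDr sqr_ge0. Qed.

Lemma normc_cexp_imag (R : realType) (r : R) : Normc.normc (cexp ('i * r%:C)) = 1.
Proof. by rewrite cexp_imag /= cos2Dsin2 sqrtr1. Qed.

(** * Fourier coefficients of the initial value *)

Section solution_coefficients.
Context {R : realType}.

(** Each half-line of integers is enumerated by an injection [e], and its weighted sums are bounded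
    by the H^1 sum over all integers. *)
Lemma in_H1_summable (f : R -> R[i]) : in_H1 f ->
  cvgn (symsum (fun k => Normc.normc (fourier f k))).
Proof.
move=> [_ fH1]; set c := fun k => Normc.normc (fourier f k).
have c0 k : 0 <= c k by rewrite /c; case: (fourier f k) => a b /=; exact: sqrtr_ge0.
pose F (k : int) : \bar R := ((1 + k%:~R ^+ 2) * c k ^+ 2)%:E.
have F0 k : (0 <= F k)%E by rewrite lee_fin mulr_ge0 ?addr_ge0 ?sqr_ge0.
have [M FM] : exists M : R, (\esum_(k in [set: int]) F k <= M%:E)%E.
  exists (fine (\esum_(k in [set: int]) F k)); rewrite fineK//.
  by rewrite ge0_fin_numE// esum_ge0.
have part (e : nat -> int) : injective e -> (forall n, `|e n|%N = n) ->
    forall N, \sum_(0 <= n < N) c (e n) <= M + 4.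
  move=> ie ae N; apply: sum_le_weighted_sqr.
  have wE n : (1 + n%:R ^+ 2 : R) = 1 + (e n)%:~R ^+ 2.
    rewrite -(real_normK (num_real ((e n)%:~R : R))) -intr_norm.
    by rewrite -abszE ae.
  rewrite -lee_fin -sumEFin; apply: le_trans FM.
  under eq_bigr do rewrite wE.
  apply: le_trans (@nneseries_lim_ge R (F \o e) xpredT 0 N (fun n _ _ => F0 (e n))) _.
  rewrite nneseries_esumT; last by move=> n; exact: F0.
  rewrite -(reindex_esum [set: nat] (range e) e F); last first.
    by apply: inj_bij => x y _ _; exact: ie.
  rewrite esum_mkcond; apply: le_esum => k _; case: ifP => _ //.
apply: (@symsum_is_cvg _ _ (M + 4)) => // N.
- by apply: (part (fun n => n%:Z)) => [m n []|n].
- by apply: (part (fun n => - n%:Z)) => [m n /oppr_inj[]|n]//; rewrite abszN.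
Qed.

(** The mu_k of the overview. *)
Let freq (k : int) : R := k%:~R / (1 + k%:~R ^+ 2).

Let freq_norm (k : int) : `|freq k| <= 2^-1.
Proof.
rewrite /freq normrM normfV ler_pdivrMr; last first.
  by rewrite normr_gt0 gt_eqF// ltr_pwDl// sqr_ge0.
rewrite [X in _ * X]ger0_norm ?addr_ge0 ?sqr_ge0//.
move: (k%:~R : R) => x; rewrite -(real_normK (num_real x)).
by have := sqr_ge0 (`|x| - 1); nra.
Qed.

(** Cross-multiplication gives [(j - k) * (1 - j * k) = 0], and [j * k = 1] forces [j = k] for
    integers. Over the reals x and 1/x would share a value. *)
Let freq_inj : injective freq.
Proof.
have w0 (k : int) : 1 + k%:~R ^+ 2 != 0 :> R by rewrite gt_eqF// ltr_pwDl// sqr_ge0.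
move=> j k /eqP; rewrite /freq eqr_div// => /eqP h.
have {}h : j * (1 + k ^+ 2) = k * (1 + j ^+ 2).
  by apply: (@intr_inj R); rewrite !intrM !intrD !rmorphXn.
have : (j - k) * (1 - j * k) = 0.
  rewrite (_ : _ * _ = j * (1 + k ^+ 2) - k * (1 + j ^+ 2)); last by ring.
  by rewrite h subrr.
move/eqP; rewrite mulf_eq0 subr_eq0 => /orP[/eqP//|].
rewrite subr_eq0 => /eqP jk; have : `|(j * k)%R|%N = 1%N by rewrite -jk.
rewrite abszM => /eqP; rewrite muln_eq1 => /andP[/eqP j1 /eqP k1].
by move: j1 k1 jk; clear; nia.
Qed.

Let lambdaE (k : int) : lambda R k = 'i * (- freq k)%:C.
Proof.
rewrite /lambda /freq rmorphN mulrN rmorphM fmorphV rmorphD rmorphXn/= !rmorph_int.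
by rewrite rmorph1 mulrA.
Qed.

Lemma fourier_coef_eq0 (T x0 : R) (f : R -> R[i]) : 0 < T -> in_H1 f ->
  (forall t : R, 0 < t < T -> solution_group t f x0 = 0) ->
  forall j, fourier f j = 0.
Proof.
move=> T0 fH1 fx0 j.
pose C k := fourier f k * cexp ('i * k%:~R * x0%:C).
have cx k : 'i * k%:~R * x0%:C = 'i * (k%:~R * x0)%:C :> R[i].
  by rewrite rmorphM rmorph_int mulrA.
pose A k := complex.Re (C k); pose B k := complex.Im (C k).
pose c k := Normc.normc (fourier f k).
have Cc k : Normc.normc (C k) = c k.
  by rewrite Normc.normcM cx normc_cexp_imag mulr1.
have cb : cvgn (symsum (fun k => 2 * c k)).
  rewrite (funext (symsumZ 2 c)); apply: is_cvgM; first exact: is_cvg_cst.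
  exact: in_H1_summable.
have Ac k : `|A k| <= c k by rewrite -Cc; exact: normc_Re.
have Bc k : `|B k| <= c k by rewrite -Cc; exact: normc_Im.
have c0 k : 0 <= c k by exact: le_trans (Ac k).
(* Real and imaginary parts of [C k * e^(- i freq_k t)]. *)
pose re t k := A k * cos (freq k * t) + B k * sin (freq k * t).
pose im t k := B k * cos (freq k * t) - A k * sin (freq k * t).
have termE t k : fourier f k * cexp (lambda R k * t%:C) *
    cexp ('i * k%:~R * x0%:C) = re t k +i* im t k.
  have lt : lambda R k * t%:C = 'i * (- (freq k * t))%:C.
    by rewrite lambdaE -[in RHS](mulNr (freq k)) [in RHS]rmorphM mulrA.
  rewrite mulrAC -/(C k) lt cexp_imag cosN sinN.
  rewrite /re /im /A /B; case: (C k) => a b.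
  by apply/eqP; rewrite eq_complex/=; apply/andP; split; apply/eqP; ring.
have bound u v t k : `|u k| <= c k -> `|v k| <= c k ->
    `|u k * cos (freq k * t) + v k * sin (freq k * t)| <= 2 * c k.
  move=> uc vc; apply: le_trans (ler_normD _ _) _.
  rewrite mulr_natl mulr2n lerD//; rewrite normrM.
  by apply: le_trans uc; rewrite ler_piMr// cos_max.
  by apply: le_trans vc; rewrite ler_piMr// sin_max.
(* A [limn] equal to 0 does not by itself give convergence, since divergent sequences get a default
   value; domination by the summable [2 * c] supplies it. *)
have [re0 im0] : (forall t, 0 < t < T -> symsum (re t) @ \oo --> (0 : R)) /\
                 (forall t, 0 < t < T -> symsum (im t) @ \oo --> (0 : R)).
  have psum t : (fun N => \sum_(l < (2 * N).+1) (fun k => fourier f k *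
      cexp (lambda R k * t%:C) * cexp ('i * k%:~R * x0%:C)) (l%:Z - N%:Z)) =
      (fun N => symsum (re t) N +i* symsum (im t) N).
    apply/funext => N; under eq_bigr do rewrite termE.
    by rewrite /symsum; elim/big_rec3: _ => // i x y z _ ->.
  have lim0 t : 0 < t < T ->
      limn (symsum (re t)) = 0 /\ limn (symsum (im t)) = 0.
    by move=> /fx0; rewrite /solution_group /zseries psum /climn/= => -[].
  split=> t tT; have [r0 i0] := lim0 t tT.
    rewrite -[X in _ --> X]r0.
    by apply: (symsum_dominated_is_cvg _ cb) => k; exact: bound.
  rewrite -[X in _ --> X]i0; apply: (symsum_dominated_is_cvg _ cb) => k.
  by rewrite /im -mulNr; apply: (bound B (fun k => - A k)); rewrite ?normrN.
pose nu k := freq j - freq k.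
have nu1 k : `|nu k| <= 1.
  by apply: le_trans (ler_normB _ _) _; have := freq_norm j; have := freq_norm k; lra.
have nut k t : nu k * t = freq j * t - freq k * t by rewrite mulrBl.
have nuj k : (nu k == 0) = (k == j).
  by rewrite subr_eq0 eq_sym (inj_eq freq_inj).
have ABc k : `|A k| + `|B k| <= 2 * c k.
  by have := Ac k; have := Bc k; lra.
have rot (a b : R) u v :
  symsum u @ \oo --> (0 : R) -> symsum v @ \oo --> (0 : R) ->
  symsum (fun k => a * u k + b * v k) @ \oo --> (0 : R).
  move=> hu hv; rewrite (funext (symsumD (fun k => a * u k) (fun k => b * v k))).
  rewrite (funext (symsumZ a u)) (funext (symsumZ b v)).
  rewrite -[X in _ --> X](addr0 (0 : R)).
  rewrite -[X in _ --> X + _](mulr0 a) -[X in _ --> _ + X](mulr0 b).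
  by apply: cvgD; apply: cvgM => //; exact: cvg_cst.
(* Multiplying the solution by [e^(i freq j t)] shifts the frequencies to [nu]. *)
have Aj : A j = 0.
  apply: (@almost_periodic_coef0 _ T nu A B (fun k => 2 * c k)) => //.
  move=> t tT.
  have := rot (cos (freq j * t)) (- sin (freq j * t)) _ _ (re0 t tT) (im0 t tT).
  rewrite (_ : (fun k => _) = (fun k =>
      A k * cos (nu k * t) - B k * sin (nu k * t)))//.
  apply/funext => k; rewrite nut cosB sinB /re /im; ring.
(* The same argument for [- i * C k], whose real and imaginary parts are [B k] and [- A k]. *)
have Bj : B j = 0.
  apply: (@almost_periodic_coef0 _ T nu B (fun k => - A k) (fun k => 2 * c k)) => //.
    by move=> k; rewrite normrN addrC; exact: ABc.
  move=> t tT.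
  have := rot (sin (freq j * t)) (cos (freq j * t)) _ _ (re0 t tT) (im0 t tT).
  rewrite (_ : (fun k => _) = (fun k =>
      B k * cos (nu k * t) - - A k * sin (nu k * t)))//.
  apply/funext => k; rewrite nut cosB sinB /re /im; ring.
apply: Normc.eq0_normc; rewrite -/(c j) -Cc.
rewrite (_ : C j = 0) ?Normc.normc0//; apply/eqP.
by rewrite eq_complex -/(A j) -/(B j) Aj Bj !eqxx.
Qed.

End solution_coefficients.

Theorem proposition1p4 (R : realType) (T : R) (f : R -> R[i])
    (hT : 0 < T) (hf : in_H1 f) :
  (forall omega : set R,
      open omega -> invariant_2pi omega -> omega !=set0 ->
      (forall x t : R, omega x -> 0 < t < T -> solution_group t f x = 0) ->
      {ae lebesgue_measure, forall x : R, f x = 0})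
  /\
  (forall x0 : R,
      (forall t : R, 0 < t < T -> solution_group t f x0 = 0) ->
      {ae lebesgue_measure, forall x : R, f x = 0}).
Proof.
have point x0 : (forall t : R, 0 < t < T -> solution_group t f x0 = 0) ->
    {ae lebesgue_measure, forall x : R, f x = 0}.
  by move=> h; apply: fourier_uniqueness hf.1 _; exact: fourier_coef_eq0 hT hf h.
(* Part (i) follows from part (ii) at any point of [omega]. *)
split=> [omega _ _ [x0 ox0] h|//].
by apply: (point x0) => t; exact: h.
Qed.
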